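(* Let $d\ge 1$ and $k\ge d+3$. The space $\mathfrak f_d^k$ of free projective shapes of $k$ landmarks in $\mathbb{RP}^d$ (with the topology defined in the context) is a $d(k-d-2)$-dimensional differentiable T1 manifold.
   Context: $\mathbb{RP}^d$ is the space of lines through the origin in $\mathbb R^{d+1}$. The group $\mathrm{PGL}(d):=\mathrm{GL}(d+1,\mathbb R)/\mathbb R^*$ acts on $\mathbb{RP}^d$ through homogeneous coordinates, and acts component-wise on the configuration space $A_d^k=(\mathbb{RP}^d)^k$ (product topology). The projective shape space is the topological quotient $\mathfrak a_d^k=A_d^k/\mathrm{PGL}(d)$. A configuration $p\in A_d^k$ is free if its isotropy group $\{g\in \mathrm{PGL}(d): gp=p\}$ is trivial. $F_d^k\subseteq A_d^k$ denotes the set of free configurations, which is invariant under $\mathrm{PGL}(d)$, and $\mathfrak f_d^k\subseteq\mathfrak a_d^k$ is the set of shapes (orbits) of free configurations, with the subspace topology from $\mathfrak a_d^k$. A differentiable manifold of dimension $N$ here means a second-countable topological space that is locally homeomorphic to $\mathbb R^N$ and carries an atlas (compatible with its topology) whose transition maps are smooth; the Hausdorff property is NOT required. A space is T1 if for any two distinct points each has an open neighborhood not containing the other. *)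

(* Defs.v *)
From HB Require Import structures.
From mathcomp Require Import all_boot all_order all_algebra.
From mathcomp Require Import all_classical all_reals all_analysis.

Set Implicit Arguments.
Unset Strict Implicit.
Unset Printing Implicit Defensive.

Import Order.TTheory GRing.Theory Num.Theory.
Import numFieldNormedType.Exports.
Local Open Scope classical_set_scope.
Local Open Scope ring_scope.
Local Open Scope quotient_scope.

(** * Real projective space *)

(* [set_type] carries the subspace topology. *)
Definition nonzero_vec (R : realType) (n : nat) : topologicalType :=
  set_type [set v : 'cV[R]_n | v != 0].

Section ProjectiveSpace.
Context (R : realType) (d : nat).
Implicit Types u v w : nonzero_vec R d.+1.

Definition same_line : rel (nonzero_vec R d.+1) :=
  fun u v => `[< exists2 c : R, c != 0 & set_val u = c *: set_val v >].

Lemma same_line_refl : reflexive same_line.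
Proof. by move=> u; apply/asboolP; exists 1; rewrite ?oner_eq0 ?scale1r. Qed.

Lemma same_line_sym : symmetric same_line.
Proof.
suff H u v : same_line u v -> same_line v u by move=> u v; apply/idP/idP; exact: H.
move=> /asboolP[c c0 e]; apply/asboolP; exists c^-1; first by rewrite invr_eq0.
by rewrite e scalerA mulVf// scale1r.
Qed.

Lemma same_line_trans : transitive same_line.
Proof.
move=> v u w /asboolP[a a0 e] /asboolP[b b0 f]; apply/asboolP; exists (a * b).
  by rewrite mulf_neq0.
by rewrite e f scalerA.
Qed.

Definition same_line_equiv :=
  EquivRel same_line same_line_refl same_line_sym same_line_trans.

Definition RP := {eq_quot same_line_equiv}.

HB.instance Definition _ := Topological.copy RP (quotient_topology RP).
HB.instance Definition _ := Quotient.on RP.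

Lemma RP_eqP u v : reflect (\pi_RP u = \pi_RP v) (same_line u v).
Proof. exact: (@eqmodP _ same_line_equiv). Qed.

End ProjectiveSpace.

(** * The general linear and projective linear groups *)

Definition GL (R : realType) (n : nat) := {M : 'M[R]_n | M \in unitmx}.

Section GLGroup.
Context (R : realType) (n : nat).

HB.instance Definition _ := SubChoice.on (GL R n).

Implicit Types A B C : GL R n.

Fact GL1_subproof : (1%:M : 'M[R]_n) \in unitmx.
Proof. exact: unitmx1. Qed.

Fact GLM_subproof A B : val A *m val B \in unitmx.
Proof. by rewrite unitmx_mul (valP A) (valP B). Qed.

Fact GLV_subproof A : invmx (val A) \in unitmx.
Proof. by rewrite unitmx_inv (valP A). Qed.

Definition GL1 : GL R n := Sub 1%:M GL1_subproof.
Definition GLM A B : GL R n := Sub (val A *m val B) (GLM_subproof A B).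
Definition GLV A : GL R n := Sub (invmx (val A)) (GLV_subproof A).

Fact GLMA : associative GLM.
Proof. by move=> A B C; apply/val_inj; rewrite /= mulmxA. Qed.
Fact GL1M : left_id GL1 GLM.
Proof. by move=> A; apply/val_inj; rewrite /= mul1mx. Qed.
Fact GLM1 : right_id GL1 GLM.
Proof. by move=> A; apply/val_inj; rewrite /= mulmx1. Qed.
Fact GLVM : left_inverse GL1 GLV GLM.
Proof. by move=> A; apply/val_inj; rewrite /= mulVmx// (valP A). Qed.
Fact GLMV : right_inverse GL1 GLV GLM.
Proof. by move=> A; apply/val_inj; rewrite /= mulmxV// (valP A). Qed.

HB.instance Definition _ := isGroup.Build (GL R n) GLMA GL1M GLM1 GLVM GLMV.

Lemma val_GLM A B : val (A * B)%g = val A *m val B. Proof. by []. Qed.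
Lemma val_GL1 : val (1%g : GL R n) = 1%:M. Proof. by []. Qed.
Lemma val_GLV A : val (A^-1)%g = invmx (val A). Proof. by []. Qed.

End GLGroup.

Section PGLGroup.
Context (R : realType) (d : nat).
Implicit Types A B C : GL R d.+1.

Definition proportional : rel (GL R d.+1) :=
  fun A B => `[< exists2 c : R, c != 0 & val A = c *: val B >].

Lemma proportional_refl : reflexive proportional.
Proof. by move=> A; apply/asboolP; exists 1; rewrite ?oner_eq0 ?scale1r. Qed.

Lemma proportional_sym : symmetric proportional.
Proof.
suff H A B : proportional A B -> proportional B A
  by move=> A B; apply/idP/idP; exact: H.
move=> /asboolP[c c0 e]; apply/asboolP; exists c^-1; first by rewrite invr_eq0.
by rewrite e scalerA mulVf// scale1r.
Qed.

Lemma proportional_trans : transitive proportional.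
Proof.
move=> B A C /asboolP[a a0 e] /asboolP[b b0 f]; apply/asboolP; exists (a * b).
  by rewrite mulf_neq0.
by rewrite e f scalerA.
Qed.

Definition proportional_equiv :=
  EquivRel proportional proportional_refl proportional_sym proportional_trans.

Definition PGL := {eq_quot proportional_equiv}.

HB.instance Definition _ := Choice.on PGL.
HB.instance Definition _ := Quotient.on PGL.

Lemma PGL_eqP A B : reflect (\pi_PGL A = \pi_PGL B) (proportional A B).
Proof. exact: (@eqmodP _ proportional_equiv). Qed.

Lemma repr_PGL A : exists2 c : R, c != 0 & val (repr (\pi_PGL A)) = c *: val A.
Proof. by apply/asboolP; apply/PGL_eqP; rewrite reprK. Qed.

Definition PGL1 : PGL := \pi_PGL 1%g.
Definition PGLM (g h : PGL) : PGL := \pi_PGL (repr g * repr h)%g.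
Definition PGLV (g : PGL) : PGL := \pi_PGL (repr g)^-1%g.

Lemma PGLM_pi A B : PGLM (\pi_PGL A) (\pi_PGL B) = \pi_PGL (A * B)%g.
Proof.
apply/PGL_eqP/asboolP; have [a a0 ea] := repr_PGL A.
have [b b0 eb] := repr_PGL B; exists (a * b); first by rewrite mulf_neq0.
by rewrite !val_GLM ea eb -scalemxAl -scalemxAr scalerA.
Qed.

Lemma PGLV_pi A : PGLV (\pi_PGL A) = \pi_PGL (A^-1)%g.
Proof.
apply/PGL_eqP/asboolP; have [a a0 ea] := repr_PGL A.
exists a^-1; first by rewrite invr_eq0.
rewrite !val_GLV ea invmxZ//; by have := valP (repr (\pi_PGL A)); rewrite ea.
Qed.

Fact PGLMA : associative PGLM.
Proof.
elim/quotW => A; elim/quotW => B; elim/quotW => C.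
by rewrite (PGLM_pi B C) (PGLM_pi A B) (PGLM_pi A) (PGLM_pi _ C) mulgA.
Qed.
Fact PGL1M : left_id PGL1 PGLM.
Proof. by elim/quotW => A; rewrite (PGLM_pi 1%g A) mul1g. Qed.
Fact PGLM1 : right_id PGL1 PGLM.
Proof. by elim/quotW => A; rewrite (PGLM_pi A 1%g) mulg1. Qed.
Fact PGLVM : left_inverse PGL1 PGLV PGLM.
Proof. by elim/quotW => A; rewrite PGLV_pi (PGLM_pi _ A) mulVg. Qed.
Fact PGLMV : right_inverse PGL1 PGLV PGLM.
Proof. by elim/quotW => A; rewrite PGLV_pi (PGLM_pi A) mulgV. Qed.

HB.instance Definition _ := isGroup.Build PGL PGLMA PGL1M PGLM1 PGLVM PGLMV.

Fact GL_act_subproof A (v : nonzero_vec R d.+1) :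
  val A *m set_val v \in [set w : 'cV[R]_d.+1 | w != 0].
Proof.
rewrite inE /=; apply/eqP => Av0; have /set_mem/= /eqP := valP v; apply.
by rewrite -[LHS](mulKmx (valP A)) -set_valE Av0 mulmx0.
Qed.

Definition GL_act A (v : nonzero_vec R d.+1) : nonzero_vec R d.+1 :=
  SigSub (GL_act_subproof A v).

Lemma set_val_GL_act A v : set_val (GL_act A v) = val A *m set_val v.
Proof. by rewrite set_valE /= set_valE. Qed.

(* The choice of representatives is irrelevant: see [PGL_act_pi]. *)
Definition PGL_act (g : PGL) (x : RP R d) : RP R d :=
  \pi_(RP R d) (GL_act (repr g) (repr x)).

Lemma PGL_act_pi A v :
  PGL_act (\pi_PGL A) (\pi_(RP R d) v) = \pi_(RP R d) (GL_act A v).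
Proof.
apply/RP_eqP/asboolP; have [a a0 ea] := repr_PGL A.
have /RP_eqP/asboolP[b b0 eb] : \pi_(RP R d) (repr (\pi_(RP R d) v)) = \pi_(RP R d) v.
  by rewrite reprK.
exists (a * b); first by rewrite mulf_neq0.
by rewrite !set_val_GL_act ea eb -scalemxAl -scalemxAr scalerA.
Qed.

Lemma PGL_act1 x : PGL_act 1%g x = x.
Proof.
elim/quotW: x => v; rewrite (PGL_act_pi 1%g); congr (\pi _).
by apply/val_inj; rewrite -set_valE set_val_GL_act mul1mx.
Qed.

Lemma PGL_actM g h x : PGL_act (g * h)%g x = PGL_act g (PGL_act h x).
Proof.
elim/quotW: g => A; elim/quotW: h => B; elim/quotW: x => v.
rewrite [(_ * _)%g](PGLM_pi A B) (PGL_act_pi B) (PGL_act_pi A) (PGL_act_pi (A * B)%g).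
by congr (\pi _); apply/val_inj; rewrite -set_valE !set_val_GL_act mulmxA.
Qed.

End PGLGroup.

(** * Configurations and shapes *)

Section ShapeSpace.
Context (R : realType) (d k : nat).

(* [{ptws _ -> _}] carries the product topology. *)
Definition config : topologicalType := {ptws 'I_k -> RP R d}.

Definition config_act (g : PGL R d) (p : config) : config :=
  fun i => PGL_act g (p i).

Lemma config_act1 p : config_act 1%g p = p.
Proof. by apply/funext => i; exact: PGL_act1. Qed.

Lemma config_actM g h p : config_act (g * h)%g p = config_act g (config_act h p).
Proof. by apply/funext => i; exact: PGL_actM. Qed.

Definition same_orbit : rel config :=
  fun p q => `[< exists g : PGL R d, config_act g p = q >].

Lemma same_orbit_refl : reflexive same_orbit.
Proof. by move=> p; apply/asboolP; exists 1%g; exact: config_act1. Qed.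

Lemma same_orbit_sym : symmetric same_orbit.
Proof.
suff H p q : same_orbit p q -> same_orbit q p
  by move=> p q; apply/idP/idP; exact: H.
move=> /asboolP[g <-]; apply/asboolP; exists (g^-1)%g.
by rewrite -config_actM mulVg config_act1.
Qed.

Lemma same_orbit_trans : transitive same_orbit.
Proof.
move=> q p r /asboolP[g <-] /asboolP[h <-]; apply/asboolP; exists (h * g)%g.
exact: config_actM.
Qed.

Definition same_orbit_equiv :=
  EquivRel same_orbit same_orbit_refl same_orbit_sym same_orbit_trans.

Definition shape_space := {eq_quot same_orbit_equiv}.

HB.instance Definition _ := Topological.copy shape_space (quotient_topology shape_space).
HB.instance Definition _ := Quotient.on shape_space.

Lemma shape_space_eqP p q :
  reflect (\pi_shape_space p = \pi_shape_space q) (same_orbit p q).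
Proof. exact: (@eqmodP _ same_orbit_equiv). Qed.

Definition isotropy (p : config) : set (PGL R d) :=
  [set g | config_act g p = p].

Definition free_config : set config := [set p | isotropy p = [set 1%g]].

Definition free_shapes : set shape_space := [set \pi_shape_space p | p in free_config].

Definition free_shape_space : topologicalType := set_type free_shapes.

End ShapeSpace.

(** * Smooth manifolds, possibly non-Hausdorff *)

Section Manifold.
Context (R : realType).

Fixpoint Cn_on (n m p : nat) (U : set 'rV[R]_m) (f : 'rV[R]_m -> 'rV[R]_p) : Prop :=
  {within U, continuous f} /\
  if n is n'.+1 then
    forall i : 'I_m,
      (forall x, U x -> derivable f x (delta_mx 0 i)) /\
      Cn_on n' U ('D_(delta_mx 0 i) f)
  else True.

(* Meant for open [U] only: the derivatives then depend on [f] on [U] alone. *)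
Definition smooth_on (m p : nat) (U : set 'rV[R]_m) (f : 'rV[R]_m -> 'rV[R]_p) :=
  forall n, Cn_on n U f.

(* A homeomorphism [chart_dom -> chart_cod]; the values of [chart_fun] and
   [chart_inv] outside these sets are irrelevant. *)
Record chart (N : nat) (T : topologicalType) := Chart {
  chart_dom : set T ;
  chart_cod : set 'rV[R]_N ;
  chart_fun : T -> 'rV[R]_N ;
  chart_inv : 'rV[R]_N -> T ;
  chart_dom_open : open chart_dom ;
  chart_cod_open : open chart_cod ;
  chart_funS : {homo chart_fun : x / chart_dom x >-> chart_cod x} ;
  chart_invS : {homo chart_inv : y / chart_cod y >-> chart_dom y} ;
  chart_funK : forall x, chart_dom x -> chart_inv (chart_fun x) = x ;
  chart_invK : forall y, chart_cod y -> chart_fun (chart_inv y) = y ;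
  chart_fun_continuous : {within chart_dom, continuous chart_fun} ;
  chart_inv_continuous : {within chart_cod, continuous chart_inv}
}.

Definition smooth_transition (N : nat) (T : topologicalType) (a b : chart N T) :=
  smooth_on (chart_cod a `&` chart_inv a @^-1` chart_dom b)
            (chart_fun b \o chart_inv a).

Definition smooth_atlas (N : nat) (T : topologicalType) (A : set (chart N T)) :=
  (forall x, exists2 a, A a & chart_dom a x) /\
  (forall a b, A a -> A b -> smooth_transition a b).

Definition differentiable_manifold (N : nat) (T : topologicalType) :=
  @second_countable T /\ exists A : set (chart N T), smooth_atlas A.

End Manifold.

(* Main.v *)
Require Import Defs.
From mathcomp Require Import all_boot all_order all_algebra.
From mathcomp Require Import all_classical all_reals all_analysis.
From mathcomp Require Import zify ring.

(** A configuration is represented by a [(d+1) x k] matrix, up to row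
operations and rescaling of the columns. If [d+1] of the columns are a basis,
they can be normalised to the unit vectors; the remaining freedom is to rescale
rows and columns. Consider the bipartite graph joining row [i] to column [j]
when the entry [(i, j)] is nonzero. The configuration is free iff the landmarks
span and this graph is connected: otherwise an idempotent, and hence a
nontrivial involution, fixes every landmark. Along a spanning tree of the graph
all entries can be rescaled to 1, which uses up the remaining freedom except for
a common factor; the [d * (k - d - 2)] other entries are then free coordinates.
So every choice of a basis and a spanning tree (a pseudo-frame) gives a chart
onto the whole Euclidean space; there are countably many of them, and the
coordinate changes are rational. T1 holds because points are closed in a chart,
while a point outside a chart domain is already separated from those inside. *)

Set Implicit Arguments.
Unset Strict Implicit.
Unset Printing Implicit Defensive.

Import Order.TTheory GRing.Theory Num.Theory.
Import numFieldNormedType.Exports.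
Local Open Scope classical_set_scope.
Local Open Scope ring_scope.
Local Open Scope quotient_scope.

(** * Rational functions *)

Section RationalFunctions.
Context (R : realType) (p q : nat).
Implicit Types (U : set 'M[R]_(p, q)) (h : 'M[R]_(p, q) -> R).

(** Functions are total, and only denominators are constrained, on [U]. As an inductive closure it
    reduces differentiability, derivatives and composition to one induction each. *)
Inductive rational_on U : ('M[R]_(p, q) -> R) -> Prop :=
| rational_cst c : rational_on U (fun=> c)
| rational_coord i j : rational_on U (fun x => x i j)
| rational_add g h :
    rational_on U g -> rational_on U h -> rational_on U (fun x => g x + h x)
| rational_mul g h :
    rational_on U g -> rational_on U h -> rational_on U (fun x => g x * h x)
| rational_inv h :
    rational_on U h -> (forall x, U x -> h x != 0) ->
    rational_on U (fun x => (h x)^-1).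

Lemma eq_rational U g h : g =1 h -> rational_on U g -> rational_on U h.
Proof. by move=> /funext ->. Qed.

Lemma rational_opp U h : rational_on U h -> rational_on U (fun x => - h x).
Proof.
move=> rh; apply: (@eq_rational _ (fun x => -1 * h x)) => [x|].
  by rewrite mulN1r.
by apply: rational_mul => //; exact: rational_cst.
Qed.

Lemma rational_sum U (I : Type) (r : seq I) (P : pred I) F :
  (forall i, P i -> rational_on U (F i)) ->
  rational_on U (fun x => \sum_(i <- r | P i) F i x).
Proof.
move=> rF; elim: r => [|i r IH].
  by apply: eq_rational (rational_cst U 0) => x; rewrite big_nil.
case Pi: (P i); last by apply: eq_rational IH => x; rewrite big_cons Pi.
by apply: eq_rational (rational_add (rF i Pi) IH) => x; rewrite big_cons Pi.
Qed.

Lemma rational_prod U (I : Type) (r : seq I) (P : pred I) F :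
  (forall i, P i -> rational_on U (F i)) ->
  rational_on U (fun x => \prod_(i <- r | P i) F i x).
Proof.
move=> rF; elim: r => [|i r IH].
  by apply: eq_rational (rational_cst U 1) => x; rewrite big_nil.
case Pi: (P i); last by apply: eq_rational IH => x; rewrite big_cons Pi.
by apply: eq_rational (rational_mul (rF i Pi) IH) => x; rewrite big_cons Pi.
Qed.

Definition rational_mx_on U (m n : nat) (A : 'M[R]_(p, q) -> 'M[R]_(m, n)) :=
  forall i j, rational_on U (fun x => A x i j).

Lemma rational_det U n (A : 'M[R]_(p, q) -> 'M[R]_n) :
  rational_mx_on U A -> rational_on U (fun x => \det (A x)).
Proof.
move=> rA; apply: rational_sum => s _; apply: rational_mul.
  exact: rational_cst.
by apply: rational_prod => i _; exact: rA.
Qed.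

Lemma rational_adj U n (A : 'M[R]_(p, q) -> 'M[R]_n) :
  rational_mx_on U A -> rational_mx_on U (fun x => \adj (A x)).
Proof.
move=> rA i j; pose M x := row' j (col' i (A x)).
apply: (@eq_rational _ (fun x => (-1) ^+ (j + i) * \det (M x))) => [x|].
  by rewrite mxE.
apply: rational_mul; first exact: rational_cst.
apply: rational_det => k l.
by apply: eq_rational (rA (lift j k) (lift i l)) => x; rewrite !mxE.
Qed.

Lemma rational_mulmx U m n l (A : 'M[R]_(p, q) -> 'M[R]_(m, n))
    (B : 'M[R]_(p, q) -> 'M[R]_(n, l)) :
  rational_mx_on U A -> rational_mx_on U B ->
  rational_mx_on U (fun x => A x *m B x).
Proof.
move=> rA rB i j.
apply: (@eq_rational _ (fun x => \sum_k A x i k * B x k j)) => [x|].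
  by rewrite mxE.
by apply: rational_sum => k _; apply: rational_mul; [exact: rA|exact: rB].
Qed.

Lemma rational_differentiable U h x :
  rational_on U h -> U x -> differentiable h x.
Proof.
move=> + Ux; elim=> {h} [c|i j|g h _ dg _ dh|g h _ dg _ dh|h _ dh h0].
- exact: differentiable_cst.
- exact: differentiable_coord.
- exact: differentiableD.
- exact: differentiableM.
- exact/differentiableV/h0.
Qed.

(** The sum, product and quotient rules keep derivatives in the class, which lets smoothness be
    proved by induction on the order. *)
Lemma rational_derive U h v : rational_on U h ->
  exists2 h', rational_on U h' & forall x, U x -> 'D_v h x = h' x.
Proof.
elim=> {h} [c|i j|g h rg [g' rg' eg] rh [h' rh' eh]
  |g h rg [g' rg' eg] rh [h' rh' eh]|h rh [h' rh' eh] h0].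
- exists (fun=> 0); first exact: rational_cst.
  by move=> x _; rewrite derive_cst.
- exists (fun=> v i j); first exact: rational_cst.
  (* A coordinate is an entry of the identity map, whose derivative in direction [v] is [v]. *)
  move=> x _; have dx := @derivable_id R 'M[R]_(p, q) x v.
  have /matrixP/(_ i j) := derive_mx dx.
  by rewrite mxE => <-; rewrite derive_id.
- exists (fun x => g' x + h' x); first exact: rational_add.
  move=> x Ux; rewrite deriveD ?eg ?eh//; apply/diff_derivable;
  by apply: rational_differentiable Ux.
- exists (fun x => g x * h' x + h x * g' x).
    by apply: rational_add; apply: rational_mul.
  move=> x Ux; rewrite deriveM ?eg ?eh//; apply/diff_derivable;
  by apply: rational_differentiable Ux.
- exists (fun x => - ((h x)^-1 * (h x)^-1) * h' x).
    apply: rational_mul => //; apply: rational_opp.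
    by apply: rational_mul; apply: rational_inv.
  move=> x Ux; rewrite deriveV ?eh//; last 2 first.
    exact: h0.
  - by apply/diff_derivable; apply: rational_differentiable Ux.
  by rewrite expr2 invfM.
Qed.

End RationalFunctions.

Lemma rational_comp (R : realType) (p q m n : nat) (U : set 'M[R]_(p, q))
    (V : set 'M[R]_(m, n)) (A : 'M[R]_(p, q) -> 'M[R]_(m, n)) h :
  rational_mx_on U A -> (forall x, U x -> V (A x)) -> rational_on V h ->
  rational_on U (h \o A).
Proof.
move=> rA AV; elim=> {h} [c|i j|g h _ rg _ rh|g h _ rg _ rh|h _ rh h0].
- exact: rational_cst.
- exact: rA.
- exact: rational_add.
- exact: rational_mul.
- by apply: rational_inv => // x /AV /h0.
Qed.

Lemma mx_continuous_at (T : topologicalType) (K : realType) (m n : nat)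
    (A : T -> 'M[K]_(m, n)) x :
  (forall i j, {for x, continuous (fun y => A y i j)}) ->
  {for x, continuous A}.
Proof.
move=> cA B [P xP PB]; rewrite nbhs_simpl/=.
pose PA (ij : 'I_m * 'I_n) y := P ij.1 ij.2 (A y ij.1 ij.2).
apply: filterS (_ : nbhs x [set y | forall ij, PA ij y]).
  by move=> y yP; apply: PB => i j; exact: (yP (i, j)).
by apply: filter_forall => -[i j]; exact/cA/xP.
Qed.

Lemma rational_mx_continuous (R : realType) (p q m n : nat)
    (U : set 'M[R]_(p, q)) (A : 'M[R]_(p, q) -> 'M[R]_(m, n)) x :
  rational_mx_on U A -> U x -> {for x, continuous A}.
Proof.
move=> rA Ux; apply: mx_continuous_at => i j.
by apply/differentiable_continuous; apply: rational_differentiable Ux.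
Qed.

(** Agreement on the open set [U] suffices, since it makes all derivatives agree there; the values
    of a transition map elsewhere are arbitrary. *)
Lemma rational_smooth (R : realType) (m p : nat) (U : set 'rV[R]_m)
    (f g : 'rV[R]_m -> 'rV[R]_p) :
  open U -> rational_mx_on U g -> {in U, f =1 g} -> smooth_on U f.
Proof.
have near_eq (h k : 'rV[R]_m -> 'rV[R]_p) x : open U -> U x ->
    {in U, h =1 k} -> {near x, h =1 k}.
  by move=> oU Ux hk; apply: filterS (open_nbhs_nbhs (conj oU Ux)) => y /mem_set /hk.
move=> oU rg fg n; elim: n f g rg fg => [|n IH] f g rg fg.
(* Both cases of the induction need continuity, transferred from [g], which equals [f] near each
   point of [U]. *)
all: have cf : {within U, continuous f}.
1,3: rewrite continuous_open_subspace// => x /set_mem Ux.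
1,2: have gf : {near x, g =1 f} by apply: near_eq => // y /fg.
1,2: have gx : g @ x --> g x := rational_mx_continuous rg Ux.
1,2: rewrite (nbhs_singleton gf) in gx.
1,2: by apply: cvg_trans gx; exact: near_eq_cvg gf.
- by [].
split=> // i; have dg x : U x -> derivable g x (delta_mx 0 i).
  move=> Ux; apply/derivable_mxP => j k; apply/diff_derivable.
  by apply: rational_differentiable Ux.
split=> [x Ux|].
  by apply: near_eq_derivable (dg x Ux); apply: near_eq => // y /fg.
have /choice[g' g'P] (jk : 'I_1 * 'I_p) : exists h, rational_on U h /\
    forall x, U x -> 'D_(delta_mx 0 i) (fun y => g y jk.1 jk.2) x = h x.
  by have [h] := rational_derive (delta_mx 0 i) (rg jk.1 jk.2); exists h.
apply: (IH _ (fun x => \matrix_(j, k) g' (j, k) x)).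
  by move=> j k; apply: eq_rational (g'P (j, k)).1 => x; rewrite mxE.
move=> x /set_mem Ux; rewrite (near_eq_derive _ (near_eq f g x oU Ux fg)).
rewrite derive_mx; last exact: dg.
by apply/matrixP => j k; rewrite !mxE; exact: (g'P (j, k)).2.
Qed.

(** * Topology of atlases *)

Lemma ptws_continuous (T U : topologicalType) (I : Type) (f : T -> {ptws I -> U}) :
  (forall i, continuous (fun x => f x i)) -> continuous f.
Proof.
move=> cf x; apply/cvg_sup => i.
exact: (@continuous_comp_initial _ _ _ (fun g : {ptws I -> U} => g i) f (cf i)).
Qed.

(** For open [X], the preimage under [pi] of the part of [V] sent into [X] is open, hence so is that
    part. Used for both projective space and the shape space. *)
Lemma quotient_map_continuous_in (T Q Y : topologicalType) (pi : T -> Q)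
    (f : Q -> Y) (V : set Q) :
  (forall U, open (pi @^-1` U) -> open U) ->
  open (pi @^-1` V) -> (forall t, V (pi t) -> {for t, continuous (f \o pi)}) ->
  {in V, continuous f}.
Proof.
move=> pi_open oV cf; apply/continuous_inP; first exact: pi_open.
move=> X oX; apply: pi_open.
have /(continuous_inP _ oV)/(_ X oX) : {in pi @^-1` V, continuous (f \o pi)}.
  by move=> t /set_mem /cf.
by [].
Qed.

(** The open boxes with rational endpoints form a countable base. *)
Lemma rV_second_countable (R : realType) (n : nat) :
  @second_countable 'rV[R]_n.
Proof.
pose box (qr : {ffun 'I_n -> rat} * {ffun 'I_n -> rat}) : set 'rV[R]_n :=
  [set x : 'rV[R]_n | forall i, ratr (qr.1 i) < x 0 i < ratr (qr.2 i)].
have boxo qr (x : 'rV[R]_n) : box qr x -> nbhs x (box qr).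
  move=> xqr; exists (fun _ i => `]ratr (qr.1 i), ratr (qr.2 i)[%classic).
    move=> i j; rewrite (ord1 i); apply: open_nbhs_nbhs; split.
      exact: itv_open.
    by rewrite /= in_itv /=; exact: xqr.
  by move=> y yqr i; have := yqr 0 i; rewrite /= in_itv.
exists (range box); first exact: sub_countable (card_image_le _ _) (countableP _).
split=> [_ [qr _ <-]|x W [P xP PW]]; first by rewrite openE; exact: boxo.
have /choice[q qP] i : exists qr : rat * rat, ratr qr.1 < x 0 i < ratr qr.2 /\
    forall y, ratr qr.1 < y < ratr qr.2 -> P 0 i y.
  have /nbhs_ballP[e /= e0 eP] := xP 0 i.
  have /rat_in_itvoo[a /itvP xa] : x 0 i - e < x 0 i by rewrite ltrBlDr ltrDl.
  have /rat_in_itvoo[b /itvP xb] : x 0 i < x 0 i + e by rewrite ltrDl.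
  exists (a, b); rewrite /= xa xb; split=> // y /andP[ay yb]; apply: eP.
  rewrite /ball/= ltr_distlC (lt_trans _ ay) ?xa//=.
  by rewrite (lt_trans yb) ?xb.
exists (box ([ffun i => (q i).1], [ffun i => (q i).2])).
  split=> [|i]; first by exists ([ffun i => (q i).1], [ffun i => (q i).2]).
  by rewrite !ffunE; exact: (qP i).1.
move=> y yq; apply: PW => i j; rewrite (ord1 i); apply: (qP j).2.
by have := yq j; rewrite !ffunE.
Qed.

Section Atlas.
Context (R : realType) (N : nat) (T : topologicalType).
Implicit Types a : chart R N T.

Lemma chart_preimage_open a (B : set 'rV[R]_N) :
  open B -> open (chart_dom a `&` chart_fun a @^-1` B).
Proof.
move: B; apply/continuous_inP; first exact: chart_dom_open.
rewrite -continuous_open_subspace; last exact: chart_dom_open.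
exact: chart_fun_continuous.
Qed.

(** Pulling a countable base of Euclidean space back along countably many charts gives a countable
    base. *)
Lemma countable_atlas_second_countable (I : countType) (c : I -> chart R N T) :
  (forall x, exists i, chart_dom (c i) x) -> @second_countable T.
Proof.
move=> cov; have [B cB [Bo Bb]] := rV_second_countable R N.
exists [set chart_dom (c ib.1) `&` chart_fun (c ib.1) @^-1` ib.2
       | ib in [set: I] `*` B].
  by apply: sub_countable (card_image_le _ _) _; exact: countableX (countableP _) cB.
split=> [_ [[i b] [_ /= bB] <-]|x W xW].
  by apply: chart_preimage_open; exact: Bo.
have [i ix] := cov x.
have := @chart_inv_continuous _ _ _ (c i).
rewrite continuous_open_subspace; last exact: chart_cod_open.
have fx : chart_cod (c i) (chart_fun (c i) x) := chart_funS ix.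
move=> /(_ _ (mem_set fx)) /(_ W).
(* Continuity of the inverse chart makes the preimage of [W] a neighbourhood of the image of [x], so
   it contains a basic set. *)
rewrite (chart_funK ix) => /(_ xW) /Bb[b [bB bx] bW].
exists (chart_dom (c i) `&` chart_fun (c i) @^-1` b).
  by split=> //; exists (i, b).
by move=> z [iz bz]; rewrite -(chart_funK iz); exact: bW.
Qed.

Lemma atlas_accessible (A : set (chart R N T)) :
  (forall x, exists2 a, A a & chart_dom a x) -> accessible_space T.
Proof.
move=> cov x y xy; have [a _ ax] := cov x.
have [ay|nay] := pselect (chart_dom a y); last first.
  by exists (chart_dom a); rewrite !inE; split=> //; exact: chart_dom_open.
exists (chart_dom a `&` chart_fun a @^-1` (~` [set chart_fun a y])).
rewrite !inE; split; last by case=> _; apply.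
  apply: chart_preimage_open; rewrite openC.
  exact/accessible_closed_set1/hausdorff_accessible/norm_hausdorff.
split=> //= e; move/eqP: xy; apply.
by rewrite -(chart_funK ax) e chart_funK.
Qed.

End Atlas.

(** * Pseudo-frames and normal forms *)

Section PseudoFrame.
Context (d k N : nat).

(* Basis columns, parent row of each column, parent column of each row other
   than the root [ord0], a bound on the number of grandparent steps from a row to
   the root, and an enumeration of the free entries. Being a [countType], this
   makes the atlas countable. *)
Definition frame_data : Type :=
  ({ffun 'I_d.+1 -> 'I_k} * {ffun 'I_k -> 'I_d.+1} * {ffun 'I_d.+1 -> 'I_k})
  * (nat * {ffun 'I_N -> 'I_d.+1 * 'I_k}).

Section Data.
Implicit Types D : frame_data.

Definition frame_basis D := D.1.1.1.
Definition col_parent D := D.1.1.2.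
Definition row_parent D := D.1.2.
Definition tree_depth D := D.2.1.
Definition free_entry D := D.2.2.

(** The root is a fixed point, so one number of steps, [tree_depth], serves for all rows. *)
Definition grandparent D i :=
  if i == ord0 then ord0 else col_parent D (row_parent D i).

Definition tree_edge D i j :=
  (i == col_parent D j) || (i != ord0) && (j == row_parent D i).

(** Basis columns must be leaves, because after normalisation they have a single nonzero entry. The
    condition on [tree_depth] rules out cycles. *)
Definition frame_axiom D :=
  [&& [forall i, col_parent D (frame_basis D i) == i],
      [forall i, (i != ord0) ==> (row_parent D i \notin codom (frame_basis D))],
      [forall i, iter (tree_depth D) (grandparent D) i == ord0],
      injectiveb (free_entry D) &
      [forall i, forall j, ((i, j) \in codom (free_entry D)) ==
        (j \notin codom (frame_basis D)) && ~~ tree_edge D i j]].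

End Data.

Definition pseudo_frame := {D : frame_data | frame_axiom D}.

Coercion data_of_frame (D : pseudo_frame) : frame_data := val D.

Section Frame.
Context (D : pseudo_frame).
Local Notation bas := (frame_basis D).
Local Notation cpar := (col_parent D).
Local Notation rpar := (row_parent D).
Local Notation entry := (free_entry D).

Lemma col_parent_basis i : cpar (bas i) = i.
Proof. by have /and5P[/forallP/(_ i)/eqP] := valP D. Qed.

Lemma row_parent_basis i i' : i != ord0 -> rpar i != bas i'.
Proof.
have /and5P[_ /forallP/(_ i)/implyP ri _ _ _] := valP D.
by move=> /ri; apply: contra => /eqP ->; exact: codom_f.
Qed.

Lemma iter_grandparent i : iter (tree_depth D) (grandparent D) i = ord0.
Proof. by have /and5P[_ _ /forallP/(_ i)/eqP] := valP D. Qed.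

Lemma free_entry_inj : injective entry.
Proof. by have /and5P[_ _ _ /injectiveP] := valP D. Qed.

Lemma mem_free_entry i j :
  ((i, j) \in codom entry) = (j \notin codom bas) && ~~ tree_edge D i j.
Proof. by have /and5P[_ _ _ _ /forallP/(_ i)/forallP/(_ j)/eqP] := valP D. Qed.

Lemma tree_edge_basis i i' : tree_edge D i (bas i') = (i == i').
Proof.
rewrite /tree_edge col_parent_basis; case: eqP => //= _.
by case: eqVneq => //= i0; rewrite eq_sym (negPf (row_parent_basis i' i0)).
Qed.

(** * Normal forms and coordinates of matrices *)

Context (R : fieldType).
Implicit Types (x y : 'rV[R]_N) (P : 'M[R]_(d.+1, k)).

(** The sum has at most one term because [free_entry] is injective; it looks up the index of a free
    entry without inverting the enumeration. *)
Definition normal_form x : 'M[R]_(d.+1, k) :=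
  \matrix_(i, j) ((tree_edge D i j)%:R + \sum_(t | entry t == (i, j)) x 0 t).

Lemma normal_form_nfree x i j :
  (i, j) \notin codom entry -> normal_form x i j = (tree_edge D i j)%:R.
Proof.
move=> nij; rewrite mxE big_pred0 ?addr0// => t; apply: contraNF nij.
by move=> /eqP <-; exact: codom_f.
Qed.

Lemma normal_form_basis x i i' : normal_form x i (bas i') = (i == i')%:R.
Proof.
by rewrite normal_form_nfree ?tree_edge_basis// mem_free_entry codom_f.
Qed.

Lemma normal_form_edge x i j : tree_edge D i j -> normal_form x i j = 1.
Proof. by move=> ij; rewrite normal_form_nfree ?ij// mem_free_entry ij andbF. Qed.

Lemma normal_form_free x t : normal_form x (entry t).1 (entry t).2 = x 0 t.
Proof.
have := codom_f entry t; rewrite [X in X \in _]surjective_pairing mem_free_entry.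
move=> /andP[_ /negPf ne]; rewrite mxE ne add0r (big_pred1 t)// => s /=.
by rewrite -surjective_pairing (inj_eq free_entry_inj).
Qed.

Lemma normal_form_inj : injective normal_form.
Proof.
by move=> x y e; apply/rowP => t; rewrite -!normal_form_free e.
Qed.

(* Multiplying by the adjugate instead of the inverse keeps the entries
   polynomial; the factor [\det] is absorbed by the later rescaling. *)
Definition cleared P := \adj (colsub bas P) *m P.

(** The entries on all tree edges are nonzero. For a basis column the entry is the determinant of
    the basis block, so that block is automatically invertible. *)
Definition admissible P :=
  (forall j, cleared P (cpar j) j != 0) /\
  (forall i, i != ord0 -> cleared P i (rpar i) != 0).

Lemma cleared_basis P i i' :
  cleared P i (bas i') = \det (colsub bas P) * (i == i')%:R.
Proof.
transitivity ((\adj (colsub bas P) *m colsub bas P) i i').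
  by rewrite !mxE; apply: eq_bigr => l _; rewrite !mxE.
by rewrite mul_adj_mx mxE mulr_natr.
Qed.

Lemma admissible_unit P : admissible P -> colsub bas P \in unitmx.
Proof.
case=> /(_ (bas ord0)) + _; rewrite col_parent_basis cleared_basis eqxx mulr1.
by rewrite unitmxE unitfE.
Qed.

(* [row_scale] and [col_scale] are forced by [row_scale P ord0 = 1] and by
   requiring the rescaled entries on tree edges to be 1. *)
Definition row_ratio P i :=
  if i == ord0 then 1 else cleared P (cpar (rpar i)) (rpar i) / cleared P i (rpar i).

Definition row_scale P i :=
  \prod_(l < tree_depth D) row_ratio P (iter l (grandparent D) i).

Definition col_scale P j := (row_scale P (cpar j) * cleared P (cpar j) j)^-1.

Definition coords P : 'rV[R]_N :=
  \row_t (row_scale P (entry t).1 * cleared P (entry t).1 (entry t).2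
          * col_scale P (entry t).2).

Lemma row_ratio_neq0 P i : admissible P -> row_ratio P i != 0.
Proof.
move=> [cP rP]; rewrite /row_ratio; have [_|i0] := eqVneq i ord0; first exact: oner_neq0.
by rewrite mulf_neq0 ?invr_eq0 ?cP ?rP.
Qed.

Lemma row_scale_neq0 P i : admissible P -> row_scale P i != 0.
Proof. by move=> aP; apply/prodf_neq0 => l _; exact: row_ratio_neq0. Qed.

Lemma col_scale_neq0 P j : admissible P -> col_scale P j != 0.
Proof.
by move=> aP; rewrite invr_eq0 mulf_neq0 ?row_scale_neq0//; exact: aP.1.
Qed.

Lemma row_scaleE P i :
  row_scale P i = row_ratio P i * row_scale P (grandparent D i).
Proof.
(* The additional last factor is taken at the root, where the ratio is 1. *)
have -> : row_scale P i =
    \prod_(l < (tree_depth D).+1) row_ratio P (iter l (grandparent D) i).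
  by rewrite big_ord_recr /= iter_grandparent /row_ratio eqxx mulr1.
by rewrite big_ord_recl; congr (_ * _); apply: eq_bigr => l _; rewrite -iterSr.
Qed.

(** Free entries agree by definition of [coords], the remaining non-edges lie off the diagonal of
    the basis block and vanish, and the scales turn the tree edges into 1. *)
Lemma normal_form_coords P : admissible P ->
  normal_form (coords P) = \matrix_(i, j)
    (row_scale P i * cleared P i j * col_scale P j).
Proof.
move=> aP; apply/matrixP => i j; rewrite [RHS]mxE.
have [/codomP[t et]|nij] := boolP ((i, j) \in codom entry).
  by rewrite -[i]/((i, j).1) -[j in LHS]/((i, j).2) et normal_form_free mxE -et.
have [ij|nedge] := boolP (tree_edge D i j); last first.
  rewrite normal_form_nfree// (negPf nedge).
  move: nij; rewrite mem_free_entry nedge andbT negbK => /codomP[i' ej].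
  move: nedge; rewrite ej tree_edge_basis cleared_basis => /negPf ->.
  by rewrite !mulr0 mul0r.
rewrite normal_form_edge// /col_scale; have [cP rP] := aP.
have rs := row_scale_neq0 _ aP.
case/orP: ij => [/eqP ->|/andP[i0 /eqP ->]].
  by rewrite divff// mulf_neq0.
(* One step of the recursion cancels the entry at [(i, rpar i)] and leaves the product that
   [col_scale] inverts. *)
rewrite row_scaleE /row_ratio /grandparent (negPf i0).
rewrite [X in X * _ / _]mulrAC divfK ?rP// [cleared _ _ _ * _]mulrC.
by rewrite divff// mulf_neq0.
Qed.

Lemma colsub_normal_form x : colsub bas (normal_form x) = 1%:M.
Proof. by apply/matrixP => i j; rewrite mxE normal_form_basis mxE. Qed.

Lemma cleared_normal_form x : cleared (normal_form x) = normal_form x.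
Proof. by rewrite /cleared colsub_normal_form adj1 mul1mx. Qed.

Lemma admissible_normal_form x : admissible (normal_form x).
Proof.
rewrite /admissible cleared_normal_form; split=> [j|i i0].
  by rewrite normal_form_edge ?oner_neq0// /tree_edge eqxx.
by rewrite normal_form_edge ?oner_neq0// /tree_edge i0 eqxx orbT.
Qed.

(* The basis columns force [A] to be diagonal, and the entries 1 along the tree
   edges propagate its first diagonal entry to all the others. *)
Lemma normal_form_rigid x y A (c : 'rV[R]_k) :
  normal_form y = A *m normal_form x *m diag_mx c ->
  exists2 a, A = a%:M & forall j, a * c 0 j = 1.
Proof.
move=> e; have Ac i i' : A i i' * c 0 (bas i') = (i == i')%:R.
  have /matrixP/(_ i (bas i')) := e.
  rewrite normal_form_basis mul_mx_diag [RHS]mxE => ->; congr (_ * _).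
  rewrite mxE (bigD1 i')//= normal_form_basis eqxx mulr1 big1 ?addr0// => l.
  by move=> /negPf li; rewrite normal_form_basis li mulr0.
have Adiag i i' : i != i' -> A i i' = 0.
  move=> /negPf ii'; have := Ac i i'; rewrite ii' => /eqP; rewrite mulf_eq0.
  case/orP => /eqP// c0; have /eqP := Ac i' i'; rewrite c0 mulr0 eqxx eq_sym.
  by rewrite oner_eq0.
have edge i j : tree_edge D i j -> A i i * c 0 j = 1.
  move=> ij; have /matrixP/(_ i j) := e.
  rewrite normal_form_edge// mul_mx_diag [RHS]mxE => ->; congr (_ * _).
  rewrite mxE (bigD1 i)//= normal_form_edge// mulr1 big1 ?addr0// => l li.
  by rewrite Adiag ?mul0r// eq_sym.
have step i : A i i = A (grandparent D i) (grandparent D i).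
  rewrite /grandparent; case: eqVneq => [->//|i0].
  have e1 : A i i * c 0 (rpar i) = 1 by rewrite edge// /tree_edge i0 eqxx orbT.
  have e2 : A (cpar (rpar i)) (cpar (rpar i)) * c 0 (rpar i) = 1.
    by rewrite edge// /tree_edge eqxx.
  apply: (@mulIf _ (c 0 (rpar i))); last by rewrite e1 e2.
  by apply: contra_eq_neq e1 => ->; rewrite mulr0 eq_sym oner_eq0.
have const i : A i i = A ord0 ord0.
  rewrite -(iter_grandparent i); elim: (tree_depth D) => // m ->.
  exact: step.
exists (A ord0 ord0) => [|j].
  apply/matrixP => i i'; rewrite mxE; case: (eqVneq i i') => [<-|/Adiag ->//].
  by rewrite const.
by rewrite -(const (cpar j)) edge// /tree_edge eqxx.
Qed.

End Frame.

(** * Projective equivalence of matrices *)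

Section ProjectiveEquivalence.
Context (R : fieldType).
Implicit Types P Q : 'M[R]_(d.+1, k).

(** The orbit relation on matrices: [A] is the projective map, [c] the change of homogeneous
    coordinates of the landmarks. *)
Definition proj_equiv P Q := exists (A : 'M[R]_d.+1) (c : 'rV[R]_k),
  [/\ A \in unitmx, forall j, c 0 j != 0 & Q = A *m P *m diag_mx c].

Lemma proj_equiv_sym P Q : proj_equiv P Q -> proj_equiv Q P.
Proof.
move=> [A [c [uA c0 ->]]]; exists (invmx A), (\row_j (c 0 j)^-1); split.
- by rewrite unitmx_inv.
- by move=> j; rewrite mxE invr_eq0.
rewrite mulmxA mulKmx// -mulmxA mulmx_diag -[LHS]mulmx1; congr (_ *m _).
by apply/matrixP => i j; rewrite !mxE mulfV.
Qed.

Lemma proj_equiv_trans Q P S :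
  proj_equiv P Q -> proj_equiv Q S -> proj_equiv P S.
Proof.
move=> [A [c [uA c0 ->]]] [B [b [uB b0 ->]]].
exists (B *m A), (\row_j (c 0 j * b 0 j)); split.
- by rewrite unitmx_mul uB.
- by move=> j; rewrite mxE mulf_neq0.
by rewrite -mulmx_diag !mulmxA.
Qed.

Context (D : pseudo_frame).

(** Up to a ratio of determinants, [cleared] only changes by nonzero row and column factors, so its
    zero pattern is invariant. *)
Lemma admissible_equiv P Q : proj_equiv P Q -> admissible D P -> admissible D Q.
Proof.
move=> [A [c [uA c0 eQ]]] aP; have uB := admissible_unit aP.
pose b := \row_i c 0 (frame_basis D i).
have eB : colsub (frame_basis D) Q = A *m colsub (frame_basis D) P *m diag_mx b.
  apply/matrixP => i j; rewrite eQ !mul_mx_diag !mxE; congr (_ * _).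
  by apply: eq_bigr => l _; rewrite !mxE.
have uC : colsub (frame_basis D) Q \in unitmx.
  rewrite eB !unitmx_mul uA uB unitmxE det_diag unitfE /=.
  by apply/prodf_neq0 => i _; rewrite mxE.
pose s := \det (colsub (frame_basis D) Q) / \det (colsub (frame_basis D) P).
have s0 : s != 0 by rewrite mulf_neq0 ?invr_eq0// -unitfE -unitmxE.
have eqc i j : cleared D Q i j = s * ((b 0 i)^-1 * cleared D P i j * c 0 j).
  have -> : cleared D Q =
      s *: (diag_mx (\row_i (b 0 i)^-1) *m cleared D P *m diag_mx c).
    (* Multiplying by the invertible basis block of [Q] turns its adjugate into a determinant. *)
    apply: (can_inj (mulKmx uC)).
    rewrite /cleared mulmxA mul_mx_adj mul_scalar_mx -scalemxAr [in RHS]eB.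
    rewrite [X in _ *: X = _]eQ.
    rewrite -!mulmxA [diag_mx b *m _]mulmxA mulmx_diag.
    have -> : diag_mx (\row_j (b 0 j * (\row_i (b 0 i)^-1) 0 j)) = 1%:M.
      apply/matrixP => i' j'; rewrite !mxE; congr (_ *+ _).
      by rewrite mulfV// mxE.
    rewrite mul1mx [colsub _ P *m _]mulmxA mul_mx_adj mul_scalar_mx.
    by rewrite -!scalemxAr scalerA divfK// -unitfE -unitmxE.
  by rewrite mul_mx_diag mul_diag_mx !mxE.
have b0 i : (b 0 i)^-1 != 0 by rewrite invr_eq0 mxE.
by case: aP => cP rP; split=> [j|i i0]; rewrite eqc;
  rewrite (mulf_neq0 s0)// mulf_neq0// mulf_neq0// ?cP ?rP.
Qed.

Lemma proj_equiv_normal_form P :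
  admissible D P -> proj_equiv P (normal_form D (coords D P)).
Proof.
move=> aP; pose r := \row_i row_scale D P i; pose c := \row_j col_scale D P j.
exists (diag_mx r *m \adj (colsub (frame_basis D) P)), c; split.
- rewrite unitmx_mul unitmxE det_diag unitfE; apply/andP; split.
    by apply/prodf_neq0 => i _; rewrite mxE row_scale_neq0.
  (* The adjugate is invertible because its product with the basis block is a nonzero scalar. *)
  have uB := admissible_unit aP.
  have := mul_mx_adj (colsub (frame_basis D) P) => /(congr1 (mem unitmx)) /=.
  rewrite unitmx_mul uB /= => ->; rewrite unitmxE det_scalar unitrX//.
- by move=> j; rewrite mxE col_scale_neq0.
rewrite normal_form_coords// -[diag_mx r *m _ *m P]mulmxA -/(cleared D P).
by rewrite mul_mx_diag mul_diag_mx; apply/matrixP => i j; rewrite !mxE.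
Qed.

(** By rigidity the row factor [a] and the column factors cancel, so the two matrices coincide. *)
Lemma normal_form_equiv x y :
  proj_equiv (normal_form D x : 'M[R]_(d.+1, k)) (normal_form D y) -> x = y.
Proof.
move=> [A [c [_ _ e]]]; have [a eA ac] := normal_form_rigid e.
apply: (@normal_form_inj D R); rewrite e eA mul_scalar_mx -scalemxAl.
by apply/matrixP => i j; rewrite mul_mx_diag !mxE mulrCA ac mulr1.
Qed.

(** Both matrices are equivalent to their normal forms, so uniqueness of the normal form replaces
    any computation of how the scales transform. *)
Lemma coords_equiv P Q : proj_equiv P Q -> admissible D P ->
  coords D P = coords D Q.
Proof.
move=> PQ aP; apply: normal_form_equiv.
apply: proj_equiv_trans (proj_equiv_sym (proj_equiv_normal_form aP)) _.
apply: (proj_equiv_trans PQ); apply: proj_equiv_normal_form.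
exact: admissible_equiv PQ aP.
Qed.

Lemma normal_formK x : coords D (normal_form D x : 'M[R]_(d.+1, k)) = x.
Proof.
apply/esym/normal_form_equiv/proj_equiv_normal_form.
exact: admissible_normal_form.
Qed.

End ProjectiveEquivalence.
End PseudoFrame.

(** * Pseudo-frames adapted to a free configuration *)

(** Connectedness is phrased through sets of rows closed under sharing a column, the form in which
    freeness yields it. [j0] is only a default parent for the root. *)
Lemma spanning_tree (d k : nat) (M : 'I_d.+1 -> 'I_k -> bool) (j0 : 'I_k) :
  (forall j, exists i, M i j) ->
  (forall S : pred 'I_d.+1, S ord0 ->
    (forall i i' j, M i j -> M i' j -> S i -> S i') -> forall i, S i) ->
  exists (cp : 'I_k -> 'I_d.+1) (rp : 'I_d.+1 -> 'I_k) (m : nat),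
  [/\ forall j, M (cp j) j, forall i, i != ord0 -> M i (rp i) &
      forall i, iter m (fun i => if i == ord0 then ord0 else cp (rp i)) i = ord0].
Proof.
move=> Mcol conn.
(* Breadth-first search: the parent of a column is a neighbour of least level. *)
pose fix reach m i {struct m} := if m is m'.+1 then
  reach m' i || [exists a, reach m' a && [exists j, M a j && M i j]]
  else i == ord0 :> 'I_d.+1.
(* The reachable rows contain the root and are closed under sharing a column. *)
have reachable i : exists m, reach m i.
  apply/asboolP; apply: (conn (fun i => `[< exists m, reach m i >])).
    by apply/asboolP; exists 0%N => /=.
  move=> a b j Ma Mb /asboolP[m rm]; apply/asboolP; exists m.+1 => /=.
  apply/orP; right; apply/existsP; exists a; rewrite rm/=.
  by apply/existsP; exists j; rewrite Ma Mb.
pose lev i := ex_minn (reachable i).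
have lev_reach i m : reach m i -> (lev i <= m)%N.
  by rewrite /lev; case: ex_minnP => l _ + /[dup] _ => /[apply].
have reach_lev i : reach (lev i) i by rewrite /lev; case: ex_minnP.
have lev0 i : lev i = 0%N -> i = ord0.
  by move=> l0; have := reach_lev i; rewrite l0 => /eqP.
have /choice[cp cpP] j : exists i, M i j /\ forall a, M a j -> (lev i <= lev a)%N.
  have [i Mi] := Mcol j.
  by case: (@arg_minnP _ i (M^~ j) lev Mi) => b Mb bmin; exists b.
have /choice[rp rpP] i : exists j, i != ord0 ->
    M i j /\ (lev (cp j) < lev i)%N.
  have [->|i0] := eqVneq i ord0; first by exists j0.
  case li : (lev i) => [|m]; first by rewrite (lev0 i li) eqxx in i0.
  (* A row of level [m.+1] shares a column with a row of level at most [m]; the parent of that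
     column has no larger level. *)
  have := reach_lev i; rewrite li /= => /orP[/lev_reach|].
    by rewrite li ltnn.
  move=> /existsP[a /andP[ra /existsP[j /andP[Ma Mi]]]]; exists j => _; split=> //.
  by rewrite ltnS (leq_trans ((cpP j).2 _ Ma))// lev_reach.
exists cp, rp, (\max_i lev i); split=> [j|i /rpP[]//|i]; first exact: (cpP j).1.
apply: lev0; apply/eqP; rewrite -leqn0.
set m := \max_i lev i.
(* Generalised for the induction: after [m] steps the level is at most [lev i - m], in truncated
   subtraction. *)
have -> : 0%N = (lev i - m)%N by apply/esym/eqP; rewrite subn_eq0 leq_bigmax.
elim: m => [|m IH]; first by rewrite subn0.
rewrite iterS; case: ifPn => [_|/rpP[_ lt]].
  by have /lev_reach : reach 0%N (ord0 : 'I_d.+1) by []; rewrite leqn0 => /eqP ->.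
by rewrite subnS -ltnS (leq_trans lt)// (leq_trans IH)// leqSpred.
Qed.

(** * Counting the free entries *)

Section Counting.
Local Open Scope set_scope.

(** The [(d + 1) * (k - d - 1)] entries outside the basis columns split into the free ones,
    [k - d - 1] column-parent edges and [d] row-parent edges. No edge is counted twice since no row
    is its own grandparent. *)
Lemma card_free_entries (d k : nat) (f : 'I_d.+1 -> 'I_k) (cp : 'I_k -> 'I_d.+1)
    (rp : 'I_d.+1 -> 'I_k) :
  (0 < d)%N -> injective f ->
  (forall i, i != ord0 -> rp i \notin codom f /\ cp (rp i) != i) ->
  #|[set ij | [&& ij.2 \notin codom f, ij.1 != cp ij.2 &
      ~~ ((ij.1 != ord0) && (ij.2 == rp ij.1))]]| = (d * (k - d - 2))%N.
Proof.
move=> d0 finj rpP; set S := [set ij | _].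
pose C := [set j | j \notin codom f].
have cC : #|C| = (k - d.+1)%N.
  have := cardC (mem (codom f)); rewrite card_codom// !card_ord => e.
  by rewrite -[k in RHS]e addKn; apply: eq_card => j; rewrite !inE.
pose X := finset.setX [set: 'I_d.+1] C.
pose U := [set (cp j, j) | j in C].
pose V := [set (i, rp i) | i in [set~ ord0]].
have cU : #|U| = #|C| by rewrite card_imset// => i j [].
have cV : #|V| = d.
  by rewrite card_imset => [|i j []//]; rewrite cardsC1 card_ord.
have inU i j : ((i, j) \in U) = (j \in C) && (i == cp j).
  apply/imsetP/andP => [[j' Cj' [-> ->]]|[Cj /eqP ->]]; last by exists j.
  by rewrite Cj' eqxx.
have inV i j : ((i, j) \in V) = (i != ord0) && (j == rp i).
  apply/imsetP/andP => [[i']|[i0 /eqP ->]]; last by exists i; rewrite ?inE.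
  by rewrite !inE => ? [-> ->].
have XE : X = S :|: (U :|: V).
  apply/finset.setP => -[i j]; rewrite !finset.in_setU inU inV !inE/=.
  case: (eqVneq i ord0) => [->|i0]; rewrite ?andbT ?orbF /=.
    by rewrite -andb_orr orNb andbT.
  case: (eqVneq j (rp i)) => [->|_].
    by rewrite (rpP i i0).1 ?eqxx /= !orbT.
  by rewrite /= andbT orbF -andb_orr orNb andbT.
have dSUV : #|S :&: (U :|: V)| = 0%N.
  apply/eqP; rewrite cards_eq0; apply/eqP/finset.setP => -[i j].
  rewrite !finset.in_setI !finset.in_setU inU inV !inE/=.
  by case: (i == cp j); case: (_ && (j == rp i)); rewrite ?andbF.
have dUV : #|U :&: V| = 0%N.
  apply/eqP; rewrite cards_eq0; apply/eqP/finset.setP => -[i j].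
  rewrite !finset.in_setI inU inV !inE; apply/negP.
  move=> /andP[/andP[_ /eqP ei] /andP[/rpP[_] + /eqP ej]].
  by rewrite -ej -ei eqxx.
have := cardsX [set: 'I_d.+1] C; rewrite -/X XE !cardsU dSUV dUV.
rewrite !subn0 cU cV cC cardsT card_ord.
have -> : (k - d - 2 = (k - d.+1).-1)%N by lia.
by move: #|S|; case: (k - d.+1)%N => [|q] s /=; rewrite ?mulSn ?mulnS; lia.
Qed.

Lemma pseudo_frame_exists (d k : nat) (f : 'I_d.+1 -> 'I_k)
    (cp : 'I_k -> 'I_d.+1) (rp : 'I_d.+1 -> 'I_k) (m : nat) :
  (0 < d)%N ->
  (forall i, cp (f i) = i) -> (forall i, i != ord0 -> rp i \notin codom f) ->
  (forall i, iter m (fun i => if i == ord0 then ord0 else cp (rp i)) i = ord0) ->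
  exists D : pseudo_frame d k (d * (k - d - 2)),
  [/\ frame_basis D =1 f, col_parent D =1 cp & row_parent D =1 rp].
Proof.
move=> d0 cpf rpf itm.
have finj : injective f := can_inj cpf.
(* A row that is its own grandparent would never reach the root. *)
have cprp i : i != ord0 -> cp (rp i) != i.
  move=> i0; apply/eqP => gi; have /eqP := i0; apply.
  rewrite -[RHS](itm i); elim: m {itm} => // l IH.
  by rewrite iterS -IH (negPf i0) gi.
have cS := card_free_entries d0 finj (fun i i0 => conj (rpf i i0) (cprp i i0)).
set S := [set ij | _] in cS.
pose e := [ffun t => enum_val (cast_ord (esym cS) t)].
pose D : frame_data d k (d * (k - d - 2)) :=
  (([ffun i => f i], [ffun j => cp j], [ffun i => rp i]), (m, e)).
have codf : codom (frame_basis D) =i codom f.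
  by move=> j; apply/codomP/codomP => -[i ->]; exists i; rewrite ffunE.
have ax : frame_axiom D.
  apply/and5P; split.
  - by apply/forallP => i; rewrite !ffunE cpf.
  - by apply/forallP => i; apply/implyP => /rpf; rewrite codf ffunE.
  - apply/forallP => i; rewrite -[X in _ == X](itm i); apply/eqP/eq_iter => a.
    by rewrite /grandparent !ffunE.
  - apply/injectiveP => s t; rewrite !ffunE => /enum_val_inj.
    exact: cast_ord_inj.
  - apply/forallP => i; apply/forallP => j; apply/eqP.
    have -> : ((i, j) \in codom (free_entry D)) = ((i, j) \in S).
      apply/codomP/idP => [[t ->]|ijS]; first by rewrite ffunE enum_valP.
      exists (cast_ord cS (enum_rank_in ijS (i, j))).
      by rewrite ffunE cast_ordK enum_rankK_in.
    by rewrite inE /tree_edge codf !ffunE negb_or.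
by exists (exist _ D ax); split=> i; rewrite ffunE.
Qed.

End Counting.

(** * Freeness of a configuration in terms of its matrix *)

Section FreeMatrix.
Context (R : numFieldType) (d k : nat).
Implicit Types (P : 'M[R]_(d.+1, k)).

(** Fixing a landmark means having its column as an eigenvector, and being trivial in [PGL] means
    being scalar. *)
Definition free_mx P := forall A : 'M[R]_d.+1, A \in unitmx ->
  (forall j, exists c, A *m col j P = c *: col j P) -> exists a, A = a%:M.

(* The involution [1 - 2 E] fixes every column of [P] up to sign. *)
Lemma free_mx_idempotent P (E : 'M[R]_d.+1) :
  free_mx P -> E *m E = E ->
  (forall j, E *m col j P = 0 \/ E *m col j P = col j P) -> E = 0 \/ E = 1%:M.
Proof.
move=> frP EE Ecol; pose A := 1%:M - 2%:R *: E.
have AA : A *m A = 1%:M.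
  rewrite /A mulmxBl mul1mx mulmxBr mulmx1 -scalemxAl -scalemxAr EE.
  rewrite scalerA -scalerBl -addrA -opprD -scalerDl.
  have -> : 2%:R + (2%:R - 2%:R * 2%:R) = 0 :> R by ring.
  by rewrite scale0r subr0.
have [|j|a Aa] := frP A.
- by have [] := mulmx1_unit AA.
- rewrite /A mulmxBl mul1mx -scalemxAl; have [->|->] := Ecol j.
    by exists 1; rewrite scaler0 subr0 scale1r.
  by exists (1 - 2%:R); rewrite scalerBl scale1r.
(* A scalar involution makes [E] scalar, and an idempotent scalar is 0 or 1. *)
have eE : E = ((1 - a) / 2%:R)%:M.
  apply: (@scalerI _ _ 2%:R); first by rewrite pnatr_eq0.
  rewrite scale_scalar_mx mulrC divfK ?pnatr_eq0//.
  by rewrite raddfB/= -Aa /A opprB addrC subrK.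
move: eE; set b := _ / _ => eE; move: EE; rewrite eE mul_scalar_mx scale_scalar_mx.
move=> /matrixP/(_ ord0 ord0); rewrite !mxE !eqxx !mulr1n => bb.
have /eqP : b * (b - 1) = 0 by rewrite mulrBr bb mulr1 subrr.
rewrite mulf_eq0 subr_eq0 => /orP[/eqP ->|/eqP ->]; [left|by right].
by rewrite raddf0.
Qed.

(** If some [w] annihilates all columns, choose [u] with [w *m u = 1]. Then [u *m w] is an
    idempotent killing every column; it is nonzero, and not the identity because its rank is at most
    1 and [0 < d]. *)
Lemma free_mx_row_free P : (0 < d)%N -> free_mx P -> row_free P.
Proof.
move=> d0 frP; apply: contraT; rewrite -kermx_eq0 => /rowV0Pn[w wP w0].
have {}wP : w *m P = 0 by apply/sub_kermxP.
have [i wi] : exists i, w 0 i != 0.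
  by apply/existsP; apply: contraNT w0; rewrite negb_exists => /forallP wi;
     apply/eqP/rowP => i; rewrite mxE; apply/eqP; have := wi i; rewrite negbK.
pose u : 'cV[R]_d.+1 := (w 0 i)^-1 *: delta_mx i 0.
have wu : w *m u = 1%:M.
  rewrite -scalemxAr -colE; apply/matrixP => a b.
  by rewrite !ord1 !mxE mulVf.
have [] := @free_mx_idempotent P (u *m w) frP.
- by rewrite mulmxA -[u *m w *m u]mulmxA wu mulmx1.
- by move=> j; left; rewrite -mulmxA colE [w *m _]mulmxA wP mul0mx mulmx0.
- move=> /(congr1 (mulmx w)); rewrite mulmxA wu mul1mx mulmx0 => w00.
  by rewrite w00 eqxx in w0.
move=> /(congr1 mxrank); rewrite mxrank1 => rk.
have := mxrankM_maxl u w; rewrite rk => /leq_trans/(_ (rank_leq_col u)).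
by rewrite ltnNge d0.
Qed.

(** Closure of [S] means that each column of the normalised matrix is supported inside or outside
    [S]. Projection onto the coordinates in [S] thus fixes or kills every column; being nonzero at
    the root, it is the identity. *)
Lemma free_mx_connected P (f : 'I_d.+1 -> 'I_k) (S : pred 'I_d.+1) :
  free_mx P -> colsub f P \in unitmx -> S ord0 ->
  (forall i i' j, (invmx (colsub f P) *m P) i j != 0 ->
    (invmx (colsub f P) *m P) i' j != 0 -> S i -> S i') ->
  forall i, S i.
Proof.
move=> frP uB S0; set B := colsub f P in uB *; set Q := invmx B *m P => conn.
have QP j : col j P = B *m col j Q by rewrite !colE /Q mulmxA mulKVmx.
move: Q conn QP => Q conn QP.
pose F : 'M[R]_d.+1 := diag_mx (\row_i (S i)%:R).
have FF : F *m F = F.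
  rewrite mulmx_diag; congr diag_mx; apply/rowP => i; rewrite !mxE.
  by rewrite -natrM mulnb andbb.
have FQ j : F *m col j Q = 0 \/ F *m col j Q = col j Q.
  have [/existsP[i /andP[Si Qij]]|/existsPn nS] :=
      boolP [exists i, S i && (Q i j != 0)]; [right|left].
    apply/colP => i'; rewrite mul_diag_mx !mxE.
    have [->|Qi'] := eqVneq (Q i' j) 0; first by rewrite mulr0.
    by rewrite (conn i i' j)// mul1r.
  apply/colP => i'; rewrite mul_diag_mx !mxE; have := nS i'.
  by case: (S i') => /=; rewrite ?mul0r// negbK => /eqP ->; rewrite mulr0.
have [] := @free_mx_idempotent P (B *m F *m invmx B) frP.
- by rewrite !mulmxA mulmxKV// -[B *m F *m F]mulmxA FF.
- move=> j; rewrite QP !mulmxA mulmxKV// -!mulmxA.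
  by have [->|->] := FQ j; [left; rewrite mulmx0|right].
- move=> /(congr1 (fun X => invmx B *m X *m B)).
  rewrite mulmx0 mul0mx !mulmxA mulVmx// mul1mx mulmxKV//.
  move=> /matrixP/(_ ord0 ord0); rewrite !mxE S0 eqxx => /eqP.
  by rewrite mulr1n oner_eq0.
move=> /(congr1 (fun X => invmx B *m X *m B)).
rewrite mulmx1 !mulmxA mulVmx// mul1mx mulmxKV//.
move=> + i => /matrixP/(_ i i); rewrite !mxE eqxx.
by case: (S i) => // /eqP; rewrite eq_sym oner_eq0.
Qed.

Lemma free_mx_admissible P : (0 < d)%N -> (forall j, col j P != 0) ->
  free_mx P ->
  exists D : pseudo_frame d k (d * (k - d - 2)), admissible D P.
Proof.
move=> d0 P0 frP.
have fP : row_full P^T.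
  by rewrite /row_full mxrank_tr; exact: free_mx_row_free d0 frP.
pose f := fullrankfun fP.
have uB : colsub f P \in unitmx.
  rewrite -unitmx_tr; have := fullrowsub_unit fP; congr (_ \in unitmx).
  by apply/matrixP => i j; rewrite !mxE.
pose Q := invmx (colsub f P) *m P.
have QB i i' : Q i (f i') = (i == i')%:R.
  transitivity ((invmx (colsub f P) *m colsub f P) i i').
    by rewrite !mxE; apply: eq_bigr => l _; rewrite mxE.
  by rewrite mulVmx// mxE.
have dB : \det (colsub f P) != 0 by rewrite -unitfE -unitmxE.
(* [cleared] and [Q] differ by a nonzero determinant, so a spanning tree for [Q] suffices. *)
have clearedE (D : pseudo_frame d k (d * (k - d - 2))) i j :
    frame_basis D =1 f -> cleared D P i j = \det (colsub f P) * Q i j.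
  move=> eb; have eB : colsub (frame_basis D) P = colsub f P.
    by apply/matrixP => i' j'; rewrite !mxE eb.
  rewrite /cleared eB /Q /invmx uB -scalemxAl [in RHS]mxE mulrA divff//.
  by rewrite mul1r.
have [|S S0 conn i|cp [rp [m [cpP rpP itm]]]] :=
    @spanning_tree d k (fun i j => Q i j != 0) (f ord0).
- move=> j; apply/existsP; apply: contraNT (P0 j); rewrite negb_exists.
  move=> /forallP Qj; suff : col j Q = 0.
    move=> /(congr1 (mulmx (colsub f P))).
    by rewrite mulmx0 !colE /Q !mulmxA mulmxV// mul1mx => ->.
  by apply/colP => i; have := Qj i; rewrite negbK [col _ _ _ _]mxE [RHS]mxE => /eqP.
- exact: free_mx_connected frP uB S0 conn i.
(* The column [f i] of [Q] is a unit vector, so row [i] is its only neighbour. *)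
have cpf i : cp (f i) = i.
  by have := cpP (f i); rewrite QB; case: (eqVneq (cp (f i)) i); rewrite // eqxx.
(* A basis column meets only its own row, so as a parent it would make [i] its own grandparent. *)
have rpf i : i != ord0 -> rp i \notin codom f.
  move=> i0; apply/codomP => -[i' e]; have := rpP _ i0; rewrite e QB.
  have gi : cp (rp i) = i' by rewrite e cpf.
  case: (eqVneq i i') => [ii'|]; last by rewrite eqxx.
  have /eqP := i0; case; rewrite -[RHS](itm i).
  by elim: m {itm} => // l IH; rewrite iterS -IH (negPf i0) gi ii'.
have [D [eb ec er]] := pseudo_frame_exists d0 cpf rpf itm.
exists D; split=> [j|i i0]; rewrite clearedE// mulf_neq0//.
  by rewrite ec.
by rewrite er rpP.
Qed.

End FreeMatrix.

(** * Charts *)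

Section Lifts.
Context (R : realType) (d k : nat).
Implicit Types (P Q : 'M[R]_(d.+1, k)) (p q : config R d k).

Lemma nonzero_vecP (v : nonzero_vec R d.+1) : set_val v != 0.
Proof. by rewrite set_valE; have /set_mem := valP v. Qed.

Definition mk_nonzero (v : 'cV[R]_d.+1) (v0 : v != 0) : nonzero_vec R d.+1 :=
  SigSub (mem_set v0 : v \in [set v : 'cV[R]_d.+1 | v != 0]).

Lemma set_val_mk_nonzero v (v0 : v != 0) : set_val (mk_nonzero v0) = v.
Proof. by rewrite set_valE. Qed.

Definition lifts P p :=
  forall j, exists2 v : nonzero_vec R d.+1, set_val v = col j P & \pi_(RP R d) v = p j.

(** The representatives are picked by choice; continuity arguments rely on [local_lift] instead. *)
Definition config_mx p : 'M[R]_(d.+1, k) :=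
  \matrix_(i, j) (set_val (repr (p j)) : 'cV[R]_d.+1) i 0.

Lemma config_mx_lifts p : lifts (config_mx p) p.
Proof.
move=> j; exists (repr (p j)); last by rewrite reprK.
by apply/colP => i; rewrite !mxE.
Qed.

Lemma lifts_col_neq0 P p j : lifts P p -> col j P != 0.
Proof. by move=> /(_ j)[v <- _]; exact: nonzero_vecP. Qed.

Lemma same_orbit_proj_equiv P Q p q :
  lifts P p -> lifts Q q -> same_orbit p q -> proj_equiv P Q.
Proof.
move=> Pp Qq /asboolP[g]; elim/quotW: g => A Apq.
have /choice[c cP] j : exists c : R, c != 0 /\ col j Q = c *: (val A *m col j P).
  have [v <- pv] := Pp j; have [w <- qw] := Qq j.
  have : \pi_(RP R d) w = \pi_(RP R d) (GL_act A v).
    by rewrite qw -PGL_act_pi pv -Apq.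
  by move=> /RP_eqP/asboolP[c c0 ->]; exists c; rewrite set_val_GL_act.
exists (val A), (\row_j c j); split; first exact: (valP A).
- by move=> j; rewrite mxE (cP j).1.
apply/matrixP => i j; have /colP/(_ i) := (cP j).2.
rewrite mul_mx_diag !mxE mulrC => ->; congr (_ * _).
by apply: eq_bigr => l _; rewrite mxE.
Qed.

Lemma proj_equiv_same_orbit P Q p q :
  lifts P p -> lifts Q q -> proj_equiv P Q -> same_orbit p q.
Proof.
move=> Pp Qq [A [c [uA c0 eQ]]]; apply/asboolP.
exists (\pi_(PGL R d) (Sub A uA : GL R d.+1)); apply/funext => j.
have [v ev pv] := Pp j; have [w ew qw] := Qq j.
rewrite /config_act -pv -qw PGL_act_pi; apply/esym/RP_eqP/asboolP.
exists (c 0 j) => //; rewrite set_val_GL_act/= ev ew eQ.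
apply/colP => i; rewrite [LHS]mxE mul_mx_diag !mxE mulrC; congr (_ * _).
by apply: eq_bigr => l _; rewrite mxE.
Qed.

Lemma proj_equiv_repr P p : lifts P p ->
  proj_equiv P (config_mx (repr (\pi_(shape_space R d k) p))).
Proof.
move=> Pp; apply: same_orbit_proj_equiv Pp (config_mx_lifts _) _.
by apply/shape_space_eqP; rewrite reprK.
Qed.

Lemma free_config_mx P p : lifts P p -> free_config p -> free_mx P.
Proof.
move=> Pp frp A uA Acol.
have : isotropy p (\pi_(PGL R d) (Sub A uA : GL R d.+1)).
  apply/funext => j; have [v ev pv] := Pp j.
  rewrite /config_act -pv PGL_act_pi; apply/RP_eqP/asboolP.
  have [c Ac] := Acol j; exists c; last by rewrite set_val_GL_act/= ev.
  (* The eigenvalue is nonzero, as the image of a nonzero vector is nonzero. *)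
  have := nonzero_vecP (GL_act (Sub A uA : GL R d.+1) v).
  by rewrite set_val_GL_act/= ev Ac; apply: contraNneq => ->; rewrite scale0r.
rewrite frp => /PGL_eqP/asboolP[c _]; rewrite val_GL1 /= => ->.
by exists c; rewrite scalemx1.
Qed.

Lemma free_mx_config P p : lifts P p -> free_mx P -> free_config p.
Proof.
move=> Pp frP; apply/seteqP; split=> [g|_ ->]; last exact: config_act1.
elim/quotW: g => A Ap; have [|j|a Aa] := frP (val A); first exact: (valP A).
  have [v <- pv] := Pp j.
  have : \pi_(RP R d) (GL_act A v) = \pi_(RP R d) v.
    by rewrite -PGL_act_pi pv -[RHS]/(p j) -[in RHS]Ap.
  by move=> /RP_eqP/asboolP[c _ e]; exists c; rewrite -set_val_GL_act.
apply/PGL_eqP/asboolP; exists a; last by rewrite Aa val_GL1 scalemx1.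
by have := valP A; rewrite Aa unitmxE det_scalar unitrX_pos// unitfE.
Qed.

(** Some homogeneous coordinate is nonzero at [x0], hence nearby. Dividing by it gives a
    scale-invariant representative, which descends continuously to the quotient. *)
Lemma line_lift (x0 : RP R d) : exists2 l : RP R d -> 'cV[R]_d.+1,
  {for x0, continuous l} & \forall x \near x0,
  exists2 v : nonzero_vec R d.+1, set_val v = l x & \pi_(RP R d) v = x.
Proof.
have [i vi] : exists i, (set_val (repr x0) : 'cV[R]_d.+1) i 0 != 0.
  apply/existsP; apply: contraNT (nonzero_vecP (repr x0)); rewrite negb_exists.
  move=> /forallP v0; apply/eqP/colP => i; rewrite mxE; apply/eqP.
  by have := v0 i; rewrite negbK.
pose cx (v : nonzero_vec R d.+1) := (set_val v : 'cV[R]_d.+1) i 0.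
pose n (v : nonzero_vec R d.+1) := (cx v)^-1 *: (set_val v : 'cV[R]_d.+1).
pose V : set (RP R d) := [set x | cx (repr x) != 0].
have ncx v : exists2 c, c != 0 & set_val (repr (\pi_(RP R d) v)) = c *: set_val v.
  by apply/asboolP/RP_eqP; rewrite reprK.
have cxpi v : (cx (repr (\pi_(RP R d) v)) != 0) = (cx v != 0).
  by rewrite /cx; have [c c0 ->] := ncx v; rewrite mxE mulf_eq0 (negPf c0).
have piV : \pi_(RP R d) @^-1` V = [set v | cx v != 0].
  by apply/seteqP; split=> v; rewrite /V /= cxpi.
have cval : continuous (set_val : nonzero_vec R d.+1 -> 'cV[R]_d.+1).
  exact: initial_continuous.
have ccx : continuous cx.
  move=> v; apply: (@continuous_comp _ _ _ (set_val : nonzero_vec R d.+1 -> _)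
    (fun u : 'cV[R]_d.+1 => u i 0)); [exact: cval|exact: coord_continuous].
have oV : open (\pi_(RP R d) @^-1` V).
  rewrite piV (_ : [set v | _] = cx @^-1` (~` [set 0])); last first.
    by apply/seteqP; split=> v /= /eqP.
  move/continuousP: ccx; apply; rewrite openC.
  exact/accessible_closed_set1/hausdorff_accessible/norm_hausdorff.
have nc v : cx v != 0 -> {for v, continuous n}.
  move=> v0; apply: (@continuous_comp _ _ _ (set_val : nonzero_vec R d.+1 -> _)
    (fun u : 'cV[R]_d.+1 => (u i 0)^-1 *: u)); first exact: cval.
  apply: (@rational_mx_continuous _ _ _ _ _ [set u | u i 0 != 0]) => // a b.
  apply: (@eq_rational _ _ _ _ (fun u => (u i 0)^-1 * u a b)) => [u|].
    by rewrite mxE.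
  apply: rational_mul; last exact: rational_coord.
  by apply: rational_inv => //; exact: rational_coord.
have npi v : n (repr (\pi_(RP R d) v)) = n v.
  rewrite /n /cx; have [c c0 ->] := ncx v.
  by rewrite mxE invfM scalerA mulrAC mulVf// mul1r.
have fpi v : V (\pi_(RP R d) v) -> {for v, continuous ((n \o repr) \o \pi_(RP R d))}.
  rewrite /V /= cxpi (_ : _ \o _ = n); first exact: nc.
  by apply/funext => w; exact: npi.
exists (n \o repr).
  have := @quotient_map_continuous_in _ (RP R d) _ (\pi_(RP R d)) (n \o repr) V
    (fun U oU => oU) oV fpi.
  by apply; rewrite inE.
have : nbhs x0 V by apply: open_nbhs_nbhs; split; [exact: oV|exact: vi].
apply: filterS => x xV.
have nx : n (repr x) != 0.
  by rewrite scaler_eq0 invr_eq0 negb_or xV nonzero_vecP.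
exists (mk_nonzero nx); first by rewrite set_val_mk_nonzero.
rewrite -[RHS]reprK; apply/RP_eqP/asboolP; exists (cx (repr x))^-1.
  by rewrite invr_eq0.
by rewrite set_val_mk_nonzero.
Qed.

Lemma local_lift (p0 : config R d k) :
  exists2 L : config R d k -> 'M[R]_(d.+1, k),
    {for p0, continuous L} & \forall p \near p0, lifts (L p) p.
Proof.
have /choice[l lP] j : exists l : RP R d -> 'cV[R]_d.+1,
    {for p0 j, continuous l} /\ \forall x \near p0 j,
    exists2 v : nonzero_vec R d.+1, set_val v = l x & \pi_(RP R d) v = x.
  by have [l] := line_lift (p0 j); exists l.
have cproj j : {for p0, continuous (fun p : config R d k => p j)}.
  exact: (@proj_continuous _ (fun _ : 'I_k => RP R d) j p0).
exists (fun p => \matrix_(i, j) l j (p j) i 0).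
  apply: mx_continuous_at => i j.
  rewrite (_ : (fun _ => _) = (fun v : 'cV[R]_d.+1 => v i 0) \o (l j \o (fun p => p j))).
    apply: continuous_comp; last exact: coord_continuous.
    by apply: continuous_comp; [exact: cproj|exact: (lP j).1].
  by apply/funext => p; rewrite /= mxE.
pose good j (p : config R d k) :=
  exists2 v : nonzero_vec R d.+1, set_val v = l j (p j) & \pi_(RP R d) v = p j.
have : \forall p \near p0, forall j, good j p.
  refine (@filter_forall _ _ good (nbhs p0) _ _) => j.
  exact: (cproj j _ (lP j).2).
apply: filterS => p pl j; have [v ev pv] := pl j; exists v => //.
by rewrite ev; apply/colP => i; rewrite !mxE.
Qed.

End Lifts.

(** * The chart of a pseudo-frame *)

Section Charts.
Context (R : realType) (d k N : nat) (D : pseudo_frame d k N).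
Implicit Types (P : 'M[R]_(d.+1, k)) (p : config R d k) (x : 'rV[R]_N).

Lemma cleared_rational (U : set 'M[R]_(d.+1, k)) : rational_mx_on U (@cleared _ _ _ D R).
Proof.
apply: rational_mulmx; last exact: rational_coord.
apply: rational_adj => i j.
by apply: eq_rational (rational_coord _ i (frame_basis D j)) => P; rewrite mxE.
Qed.

(** The denominators are the tree-edge entries and the row scales, all nonzero on admissible
    matrices. *)
Lemma coords_rational : 
  rational_mx_on [set P | admissible D P] (@coords _ _ _ D R).
Proof.
have rc := cleared_rational [set P | admissible D P].
have rs i : rational_on [set P | admissible D P] (fun P => row_scale D P i).
  apply: rational_prod => l _; rewrite /row_ratio.
  have [_|i0] := eqVneq (iter l (grandparent D) i) ord0; first exact: rational_cst.
  by apply: rational_mul => //; apply: rational_inv => // P [_]; exact.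
move=> i t.
pose e := free_entry D t.
apply: (@eq_rational _ _ _ _ (fun P =>
  row_scale D P e.1 * cleared D P e.1 e.2 * col_scale D P e.2)).
  by move=> P; rewrite [RHS]mxE.
apply: rational_mul; first exact: rational_mul.
apply: rational_inv; first exact: rational_mul.
by move=> P aP; rewrite mulf_neq0 ?row_scale_neq0//; exact: aP.1.
Qed.

Lemma normal_form_rational (U : set 'rV[R]_N) : rational_mx_on U (@normal_form _ _ _ D R).
Proof.
move=> i j; apply: (@eq_rational _ _ _ _ (fun x =>
  (tree_edge D i j)%:R + \sum_(t | free_entry D t == (i, j)) x 0 t)).
  by move=> x; rewrite mxE.
apply: rational_add; first exact: rational_cst.
by apply: rational_sum => t _; exact: rational_coord.
Qed.

(** Admissibility is the nonvanishing of one polynomial, the product of the entries on the tree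
    edges. *)
Lemma open_admissible : open [set P : 'M[R]_(d.+1, k) | admissible D P].
Proof.
pose h P := \prod_j cleared D P (col_parent D j) j *
  \prod_(i | i != ord0) cleared D P i (row_parent D i).
rewrite (_ : mkset _ = h @^-1` (~` [set 0])); last first.
  apply/seteqP; split=> P /=.
    by move=> [cP rP]; apply/eqP; rewrite mulf_neq0//; apply/prodf_neq0 => *; auto.
  by move=> /eqP; rewrite mulf_eq0 negb_or => /andP[/prodf_neq0 cP /prodf_neq0 rP];
     split=> *; auto.
have ch : continuous h.
  move=> P; apply/differentiable_continuous/(@rational_differentiable _ _ _ setT) => //.
  by apply: rational_mul; apply: rational_prod => *; exact: cleared_rational.
move/continuousP: ch; apply; rewrite openC.
exact/accessible_closed_set1/hausdorff_accessible/norm_hausdorff.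
Qed.

Definition admissible_shape : set (shape_space R d k) :=
  [set s | admissible D (config_mx (repr s))].

Definition shape_coords (s : shape_space R d k) : 'rV[R]_N :=
  coords D (config_mx (repr s)).

(** By invariance under [proj_equiv], any lift can replace the chosen representative. *)
Lemma admissible_shape_pi P p : lifts P p ->
  admissible_shape (\pi_(shape_space R d k) p) <-> admissible D P.
Proof.
move=> /proj_equiv_repr Pp; split; apply: admissible_equiv => //.
exact: proj_equiv_sym.
Qed.

Lemma shape_coords_pi P p : lifts P p -> admissible D P ->
  shape_coords (\pi_(shape_space R d k) p) = coords D P.
Proof. by move=> /proj_equiv_repr Pp aP; apply/esym/coords_equiv. Qed.

Lemma open_admissible_pi :
  open (\pi_(shape_space R d k) @^-1` admissible_shape).
Proof.
rewrite openE => p /(admissible_shape_pi (config_mx_lifts p)) ap.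
have [L Lc Ll] := local_lift p.
have aL : admissible D (L p).
  apply/(admissible_shape_pi (nbhs_singleton Ll)).
  exact/(admissible_shape_pi (config_mx_lifts p)).
have := Lc _ (open_nbhs_nbhs (conj open_admissible aL)).
apply: filterS2 Ll => q Lq aq; exact/(admissible_shape_pi Lq).
Qed.

Lemma open_admissible_shape : open admissible_shape.
Proof. exact: open_admissible_pi. Qed.

Lemma shape_coords_continuous : {in admissible_shape, continuous shape_coords}.
Proof.
apply: (@quotient_map_continuous_in _ (shape_space R d k) _
  (\pi_(shape_space R d k)) _ _ (fun U oU => oU) open_admissible_pi) => p ap.
have [L Lc Ll] := local_lift p.
have aL : admissible D (L p) by apply/(admissible_shape_pi (nbhs_singleton Ll)).
have cL : {for p, continuous (@coords _ _ _ D R \o L)}.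
  apply: continuous_comp; first exact: Lc.
  exact: rational_mx_continuous coords_rational aL.
(* Near [p] the coordinates of the shape can be computed from the continuous lift [L]. *)
have ev : {near p, @coords _ _ _ D R \o L =1 shape_coords \o \pi_(shape_space R d k)}.
  have := Lc _ (open_nbhs_nbhs (conj open_admissible aL)).
  by apply: filterS2 Ll => q Lq aq; rewrite /= (shape_coords_pi Lq).
have cLp : @coords _ _ _ D R \o L @ p --> (@coords _ _ _ D R \o L) p := cL.
rewrite (nbhs_singleton ev) in cLp.
by apply: cvg_trans cLp; exact: near_eq_cvg ev.
Qed.

Lemma normal_form_col_neq0 x j : col j (normal_form D x) != 0.
Proof.
have := (admissible_normal_form D x).1 j; rewrite cleared_normal_form.
by apply: contraNneq => /colP/(_ (col_parent D j)); rewrite [LHS]mxE [RHS]mxE => ->.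
Qed.

Definition normal_config x : config R d k :=
  fun j => \pi_(RP R d) (mk_nonzero (normal_form_col_neq0 x j)).

Lemma normal_config_lifts x : lifts (normal_form D x) (normal_config x).
Proof.
by move=> j; exists (mk_nonzero (normal_form_col_neq0 x j)); rewrite ?set_val_mk_nonzero.
Qed.

Lemma normal_config_free x : free_config (normal_config x).
Proof.
apply: free_mx_config (normal_config_lifts x) _ => A uA /choice[c Ac].
have c0 j : c j != 0.
  apply: contraNneq (normal_form_col_neq0 x j) => cj.
  by rewrite -(mulKmx uA (col j _)) Ac cj scale0r mulmx0.
(* The eigenvector equations say that [A] and the inverse eigenvalues carry the normal form to
   itself, so rigidity makes [A] scalar. *)
suff e : normal_form D x = A *m normal_form D x *m diag_mx (\row_j (c j)^-1).
  by have [a ->] := normal_form_rigid e; exists a.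
apply/matrixP => i j; have /colP/(_ i) := Ac j.
have -> : (A *m col j (normal_form D x)) i 0 = (A *m normal_form D x) i j.
  by rewrite !mxE; apply: eq_bigr => l _; rewrite !mxE.
move=> e; rewrite mul_mx_diag [RHS]mxE e [X in X * _]mxE.
by rewrite [X in _ * X * _]mxE [X in _ * X]mxE mulrAC mulfV// mul1r.
Qed.

Lemma normal_shape_free x :
  \pi_(shape_space R d k) (normal_config x) \in @free_shapes R d k.
Proof.
by rewrite inE; exists (normal_config x) => //; exact: normal_config_free.
Qed.

Definition normal_shape x : free_shape_space R d k := SigSub (normal_shape_free x).

Lemma set_val_normal_shape x :
  set_val (normal_shape x) = \pi_(shape_space R d k) (normal_config x).
Proof. by rewrite set_valE. Qed.

Lemma normal_config_continuous : continuous normal_config.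
Proof.
apply: ptws_continuous => j.
have cv : continuous (fun y => mk_nonzero (normal_form_col_neq0 y j)).
  apply: continuous_comp_initial => y.
  rewrite (_ : _ \o _ = (fun y => col j (normal_form D y))); last first.
    by apply/funext => z; exact: set_val_mk_nonzero.
  apply: (@rational_mx_continuous _ _ _ _ _ setT) => // a b.
  by apply: eq_rational (@normal_form_rational setT a j) => z; rewrite [RHS]mxE.
move=> y; apply: (@continuous_comp _ _ _ _ (\pi_(RP R d))); first exact: cv.
exact: pi_continuous.
Qed.

Lemma normal_shape_continuous : continuous normal_shape.
Proof.
apply: continuous_comp_initial.
rewrite (_ : _ \o _ = \pi_(shape_space R d k) \o normal_config); last first.
  by apply/funext => x; exact: set_val_normal_shape.
move=> x; apply: continuous_comp; first exact: normal_config_continuous.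
exact: pi_continuous.
Qed.

Definition frame_dom : set (free_shape_space R d k) := set_val @^-1` admissible_shape.

Lemma frame_dom_open : open frame_dom.
Proof.
have /continuousP := @initial_continuous _ _ (set_val : free_shape_space R d k -> _).
by apply; exact: open_admissible_shape.
Qed.

Lemma admissible_normal_shape x : frame_dom (normal_shape x).
Proof.
rewrite /frame_dom /= set_val_normal_shape.
apply/(admissible_shape_pi (normal_config_lifts x)); exact: admissible_normal_form.
Qed.

Lemma shape_coordsK (s : free_shape_space R d k) :
  frame_dom s -> normal_shape (shape_coords (set_val s)) = s.
Proof.
move=> sD; apply: val_inj; rewrite -!set_valE set_val_normal_shape.
rewrite -[RHS]reprK; apply/shape_space_eqP.
apply: (proj_equiv_same_orbit (normal_config_lifts _) (config_mx_lifts _)).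
exact/proj_equiv_sym/proj_equiv_normal_form.
Qed.

Lemma normal_shapeK x : shape_coords (set_val (normal_shape x)) = x.
Proof.
rewrite set_val_normal_shape (shape_coords_pi (normal_config_lifts x)).
  exact: normal_formK.
exact: admissible_normal_form.
Qed.

Lemma shape_coords_within :
  {within frame_dom, continuous (shape_coords \o set_val)}.
Proof.
rewrite continuous_open_subspace; last exact: frame_dom_open.
move=> s sD; apply: continuous_comp; first exact: initial_continuous.
by apply: shape_coords_continuous; move: sD; rewrite !inE.
Qed.

Definition frame_chart : chart R N (free_shape_space R d k) :=
  @Chart R N (free_shape_space R d k) frame_dom setT (shape_coords \o set_val)
    normal_shape frame_dom_open openT (fun _ _ => I)
    (fun x _ => admissible_normal_shape x) shape_coordsK
    (fun x _ => normal_shapeK x) shape_coords_within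
    (continuous_subspaceT normal_shape_continuous).

End Charts.

Lemma frame_transition_smooth (R : realType) (d k N : nat)
    (D D' : pseudo_frame d k N) :
  smooth_transition (frame_chart R D) (frame_chart R D').
Proof.
have nfc : continuous (@normal_form _ _ _ D R).
  by move=> x; apply: rational_mx_continuous (@normal_form_rational _ _ _ _ D setT) _.
(* [U] is the chart overlap in the coordinates of [D]; there the transition is [coords D'] after
   [normal_form D], hence rational. *)
pose U := @normal_form _ _ _ D R @^-1` [set P | admissible D' P].
rewrite /smooth_transition (_ : _ `&` _ = U).
  apply: (@rational_smooth R N N U _ (fun x => coords D' (normal_form D x))).
  - by move/continuousP: nfc; apply; exact: open_admissible.
  - move=> i j; apply: (@rational_comp _ _ _ _ _ U _ (@normal_form _ _ _ D R)
      (fun P => coords D' P i j) _ _ (coords_rational R D' i j)) => //.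
    exact: normal_form_rational.
  move=> x /set_mem /= xU; rewrite set_val_normal_shape.
  exact: shape_coords_pi (normal_config_lifts D x) xU.
rewrite setTI; apply/seteqP; split=> x /=; rewrite /frame_dom /= set_val_normal_shape;
by move/(admissible_shape_pi D' (normal_config_lifts D x)).
Qed.

Lemma free_shape_covered (R : realType) (d k : nat) (d0 : (0 < d)%N)
    (s : free_shape_space R d k) :
  exists D : pseudo_frame d k (d * (k - d - 2)), chart_dom (frame_chart R D) s.
Proof.
have [p frp ps] : free_shapes (set_val s) by rewrite set_valE; exact: set_mem (valP s).
have Pp := config_mx_lifts p.
have [j|D aD] := @free_mx_admissible R d k (config_mx p) d0 _ (free_config_mx Pp frp).
  exact: lifts_col_neq0 Pp.
by exists D; rewrite /= /frame_dom /= -ps; apply/(admissible_shape_pi D Pp).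
Qed.

Theorem theorem5p8 (R : realType) (d k : nat)
    (hd : (1 <= d)%N) (hk : (d + 3 <= k)%N) :
  differentiable_manifold R (d * (k - d - 2))%N (free_shape_space R d k) /\
  accessible_space (free_shape_space R d k).
Proof.
pose A := range (fun D : pseudo_frame d k (d * (k - d - 2)) => frame_chart R D).
have covA s : exists2 a, A a & chart_dom a s.
  by have [D sD] := free_shape_covered hd s; exists (frame_chart R D) => //; exists D.
split; last exact: atlas_accessible covA.
(* Pseudo-frames form a [countType], so the covering atlas is countable. *)
split; first exact: countable_atlas_second_countable (free_shape_covered hd).
exists A; split=> // _ _ [D _ <-] [D' _ <-]; exact: frame_transition_smooth.
Qed.
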